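(* Let $\alpha>-1$. Consider the nonlinear difference equation, for $j\ge2$, $$(2+\gamma_j-\gamma_{j+1})+\frac{1}{\gamma_{j-1}}(j-1)(j+\alpha)-\frac{1}{\gamma_j}\,j(j+\alpha+1)=0 .$$ Then: (i) The solution with initial values $\gamma_1=\alpha+2$ and $\gamma_2=\alpha+3$ is $\gamma_n=n+\alpha+1$, $n\ge1$. (ii) With this choice of $\gamma_n$, for all $n\ge1$ the quasi-Christoffel Laguerre polynomial $$L^{QC}_n(x;0)=\mathcal L^{(\alpha+1)}_n(x)+(n+\alpha+1)\mathcal L^{(\alpha+1)}_{n-1}(x)$$ equals $x\,\mathcal L^{(\alpha+2)}_{n-1}(x)$. (iii) For all $n\ge2$, $$L^{QC}_{n+1}(x;0)=(x-c^{qc}_{n+1})L^{QC}_n(x;0)-\lambda^{qc}_{n+1}L^{QC}_{n-1}(x;0),\qquad \lambda^{qc}_{n+1}=(n-1)(n+\alpha+1),\quad c^{qc}_{n+1}=2n+\alpha+1 .$$ (iv) The polynomials $L^{QC}_n(x;0)$, $n\ge1$, are orthogonal with respect to $d\mu=x^{\alpha}e^{-x}\,dx$ on $(0,\infty)$.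
   Context: For $a>-1$, $\mathcal L^{(a)}_n(x)$ denotes the monic Laguerre polynomial of degree $n$, defined by $\mathcal L^{(a)}_{-1}=0$, $\mathcal L^{(a)}_0=1$ and $$\mathcal L^{(a)}_{n+1}(x)=(x-(2n+a+1))\mathcal L^{(a)}_n(x)-n(n+a)\mathcal L^{(a)}_{n-1}(x),\quad n\ge0;$$ these are orthogonal on $(0,\infty)$ with respect to $x^ae^{-x}$. A family of polynomials $(p_n)_{n\ge n_0}$ is orthogonal with respect to a measure $\mu$ if $\int p_np_m\,d\mu$ converges absolutely for all $n,m\ge n_0$, is $0$ for $n\ne m$ and is nonzero for $n=m$. *)

(* Defs.v *)
From HB Require Import structures.
From mathcomp Require Import all_boot all_order all_algebra.
From mathcomp Require Import all_classical all_reals all_analysis.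
From mathcomp Require Import measurable_realfun.

Set Implicit Arguments.
Unset Strict Implicit.
Unset Printing Implicit Defensive.

Import Order.TTheory GRing.Theory Num.Theory.
Import numFieldNormedType.Exports.

Local Open Scope classical_set_scope.
Local Open Scope ring_scope.

(* Monic Laguerre polynomials; the inner match is L_{n-1}, with L_{-1} = 0. *)
Fixpoint laguerre (R : realType) (a : R) (n : nat) : {poly R} :=
  if n is m.+1 then
    ('X - (2 * m%:R + a + 1)%:P) * laguerre a m
    - (m%:R * (m%:R + a)) *: (if m is k.+1 then laguerre a k else 0)
  else 1.

(* L^QC_n(x; 0) for coefficients gamma. Since the index is a nat and n.-1 = 0
   when n = 0, only the values at n >= 1 are meaningful. *)
Definition laguerreQC (R : realType) (alpha : R) (gamma : nat -> R) (n : nat)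
    : {poly R} :=
  laguerre (alpha + 1) n + gamma n *: laguerre (alpha + 1) n.-1.

(* Division is total here, so the gamma_j (j >= 1) occurring as denominators
   are explicitly required to be nonzero. The value gamma 0 plays no role. *)
Definition solves_gamma_eq (R : realType) (alpha : R) (gamma : nat -> R) :=
  (forall j : nat, (1 <= j)%N -> gamma j != 0) /\
  (forall j : nat, (2 <= j)%N ->
     (2 + gamma j - gamma j.+1)
     + 1 / gamma j.-1 * ((j%:R - 1) * (j%:R + alpha))
     - 1 / gamma j * (j%:R * (j%:R + alpha + 1)) = 0).

Definition orthogonal_polys (R : realType)
    (mu : {measure set (measurableTypeR R) -> \bar R})
    (n0 : nat) (p : nat -> {poly R}) :=
  forall n m : nat, (n0 <= n)%N -> (n0 <= m)%N ->
    [/\ mu.-integrable setT (fun x : R => ((p n).[x] * (p m).[x])%:E),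
        n != m -> (\int[mu]_x ((p n).[x] * (p m).[x])%:E = 0)%E
      & n = m -> (\int[mu]_x ((p n).[x] * (p m).[x])%:E <> 0)%E].

Definition laguerre_weight (R : realType) (alpha : R) : R -> R :=
  (fun x : R => x `^ alpha * expR (- x)) \_ `]0, +oo[.

Definition laguerre_measure (R : realType) (alpha : R)
    (A : set (measurableTypeR R)) : \bar R :=
  (\int[lebesgue_measure]_(x in A) (laguerre_weight alpha x)%:E)%E.

Section laguerre_measure_isMeasure.
Context {R : realType}.
Variable alpha : R.

Lemma laguerre_weight_ge0 x : 0 <= laguerre_weight alpha x.
Proof.
by apply: restrict_ge0 => {}x _; rewrite mulr_ge0 ?powR_ge0 ?expR_ge0.
Qed.

Lemma measurable_laguerre_weight :
  measurable_fun [set: R] (laguerre_weight alpha).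
Proof.
apply/measurable_restrict => //; apply: measurable_funTS.
apply: measurable_funM; first exact: measurable_powR.
exact: measurableT_comp (@measurable_expR R) (@oppr_measurable R setT).
Qed.

Let mu0 : laguerre_measure alpha set0 = 0%E.
Proof. by rewrite /laguerre_measure integral_set0. Qed.

Let mu_ge0 A : (0 <= laguerre_measure alpha A)%E.
Proof. by apply: integral_ge0 => x _; rewrite lee_fin laguerre_weight_ge0. Qed.

Let mu_sigma_additive : semi_sigma_additive (laguerre_measure alpha).
Proof.
apply: semi_sigma_additive_nng_induced.
  by apply/measurable_EFinP; exact: measurable_laguerre_weight.
by move=> x; rewrite lee_fin laguerre_weight_ge0.
Qed.

HB.instance Definition _ := isMeasure.Build _ _ _
  (laguerre_measure alpha) mu0 mu_ge0 mu_sigma_additive.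

End laguerre_measure_isMeasure.

(* Main.v *)
From HB Require Import structures.
Require Import Defs.
From mathcomp Require Import all_boot all_order all_algebra.
From mathcomp Require Import all_classical all_reals all_analysis.
From mathcomp Require Import measurable_realfun ring lra.

Import Order.TTheory GRing.Theory Num.Theory.
Import numFieldNormedType.Exports.

Local Open Scope classical_set_scope.
Local Open Scope ring_scope.

(** Since j + alpha + 1 never vanishes, the difference equation determines
    gamma_{j+1} from gamma_{j-1} and gamma_j, so two initial values fix the
    solution and (i) is a verification ([gamma_solution_unique]).

    The contiguous relation L_{n+1}^(a) + (n+1+a) L_n^(a) = x L_n^(a+1)
    ([laguerre_connection]) gives (ii), and (iii) is then x times the recurrence
    of the polynomials with parameter b = alpha + 2.

    For (iv), the two factors x in L^QC_n L^QC_m turn the weight x^alpha e^-x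
    into x^b e^-x, so the claim is the orthogonality of the Laguerre
    polynomials with parameter b. Let L(p) be the integral of p(x) x^b e^-x over
    the half-line. Integration by parts gives the Pearson identity
    L(x p' + (b+1-x) p) = 0 ([laguerre_functional_pearson]); combined with the
    raising relation L_{n+1} = - (x L_n' + (b+1-x) L_n + n L_n) it shows that
    L(L_{n+1} q) = L(L_n (x q' - n q)). Taking q = L_m and expressing x L_m' by
    the lowering relation yields a recursion on the Gram matrix
    ([pearson_laguerre_step]) from which both the vanishing off the diagonal
    and the value of the norms follow by induction, without derivatives of
    higher order or Rodrigues' formula. *)

(** * The difference equation *)

Lemma gamma_solution_unique {R : realType} (alpha : R) (halpha : -1 < alpha)
    (gamma : nat -> R) :
     [/\ solves_gamma_eq alpha gamma,
         gamma 1%N = alpha + 2 & gamma 2%N = alpha + 3]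
     <-> (forall n : nat, (1 <= n)%N -> gamma n = n%:R + alpha + 1).
Proof.
have pos n : (1 <= n)%N -> n%:R + alpha + 1 != 0.
  by rewrite -(ler_nat R) => n1; rewrite gt_eqF//; lra.
(* Left-hand side of the equation at j when gamma_{j-1} and gamma_j have the
   expected values and x stands for gamma_{j+1}. *)
have value (j : nat) (x : R) : (2 <= j)%N ->
  (2 + (j%:R + alpha + 1) - x)
     + 1 / (j.-1%:R + alpha + 1) * ((j%:R - 1) * (j%:R + alpha))
     - 1 / (j%:R + alpha + 1) * (j%:R * (j%:R + alpha + 1))
  = j.+1%:R + alpha + 1 - x.
  case: j => // j j1.
  have := pos j j1; have := pos j.+1 isT; rewrite -!natr1 => h1 h2.
  by field; rewrite h1.
split=> [[[_ eqg] g1 g2] n|g].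
- suff H k : gamma k.+1 = k.+1%:R + alpha + 1 /\
             gamma k.+2 = k.+2%:R + alpha + 1.
    by case: n => // n _; have [] := H n.
  elim: k => [|k [IH1 IH2]]; first by rewrite g1 g2; split; ring.
  split=> //; have := eqg k.+2 isT; rewrite /= IH1 IH2 value//.
  by move/eqP; rewrite subr_eq0 => /eqP.
- split; [split=> [j j1|j j2]| |].
  + by rewrite g// pos.
  + have j1 : (1 <= j.-1)%N by case: j j2.
    by rewrite !g ?(ltnW j2)// value// subrr.
  + by rewrite g//; ring.
  + by rewrite g//; ring.
Qed.

(** * Relations between Laguerre polynomials *)

Lemma laguerre1 {R : realType} (a : R) : laguerre a 1 = 'X - (a + 1)%:P.
Proof. by rewrite /= mul0r scaler0 subr0 mulr1 mulr0 add0r. Qed.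

Lemma laguerreSS {R : realType} (a : R) (n : nat) :
  laguerre a n.+2 =
    ('X - (2 * n.+1%:R + a + 1)%:P) * laguerre a n.+1
    - (n.+1%:R * (n.+1%:R + a)) *: laguerre a n.
Proof. by []. Qed.

(** Both sides satisfy compatible three-term recurrences, hence the induction
    on two consecutive values. *)
Lemma laguerre_connection {R : realType} (a : R) (n : nat) :
  laguerre a n.+1 + (n.+1%:R + a) *: laguerre a n = 'X * laguerre (a + 1) n.
Proof.
suff: laguerre a n.+1 + (n.+1%:R + a) *: laguerre a n =
        'X * laguerre (a + 1) n /\
      laguerre a n.+2 + (n.+2%:R + a) *: laguerre a n.+1 =
        'X * laguerre (a + 1) n.+1.
  by case.
elim: n => [|n [IH1 IH2]].
  rewrite laguerreSS !laguerre1 -!mul_polyC /=.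
  by split; ring.
split => //.
have -> : 'X * laguerre (a + 1) n.+2 =
    ('X - (2 * n.+1%:R + (a + 1) + 1)%:P) * ('X * laguerre (a + 1) n.+1)
    - (n.+1%:R * (n.+1%:R + (a + 1))) *: ('X * laguerre (a + 1) n).
  by rewrite laguerreSS -!mul_polyC; ring.
rewrite -IH2 -IH1 (laguerreSS a n.+1) (laguerreSS a n) -!mul_polyC.
ring.
Qed.

(** At n = 0 the junk value laguerre a 0.-1 has coefficient 0. *)
Lemma laguerre_lowering {R : realType} (a : R) (n : nat) :
  'X * (laguerre a n)^`() =
    n%:R *: laguerre a n + (n%:R * (n%:R + a)) *: laguerre a n.-1.
Proof.
suff: 'X * (laguerre a n)^`() =
    n%:R *: laguerre a n + (n%:R * (n%:R + a)) *: laguerre a n.-1 /\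
  'X * (laguerre a n.+1)^`() =
    n.+1%:R *: laguerre a n.+1 + (n.+1%:R * (n.+1%:R + a)) *: laguerre a n.
  by case.
elim: n => [|n [IH1 IH2]].
  rewrite laguerre1 /= -[1]/(1%:P) derivB derivX !derivC -!mul_polyC.
  by split; ring.
split=> //.
(* The recurrence, in a form that also holds at n = 0. *)
have rec : (n%:R * (n%:R + a)) *: laguerre a n.-1 =
    ('X - (2 * n%:R + a + 1)%:P) * laguerre a n - laguerre a n.+1.
  case: n {IH1 IH2} => [|n].
    by rewrite laguerre1 /= mul0r scale0r mulr1 mulr0 add0r subrr.
  by rewrite (laguerreSS a n) /=; ring.
rewrite rec in IH1.
rewrite laguerreSS derivB derivM derivB derivX derivC subr0 mul1r derivZ.
rewrite mulrBr mulrDr mulrCA IH2 -scalerAr IH1 -!mul_polyC.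
ring.
Qed.

(** The grouping isolates the Pearson operator x p' + (a+1-x) p, whose values
    integrate to 0 against x^a e^-x. *)
Lemma laguerre_raising {R : realType} (a : R) (n : nat) :
  laguerre a n.+1 =
    - ('X * (laguerre a n)^`() + ((a + 1)%:P - 'X) * laguerre a n
       + n%:R *: laguerre a n).
Proof.
rewrite laguerre_lowering; case: n => [|n].
  rewrite laguerre1 -!mul_polyC /=; ring.
rewrite laguerreSS -!mul_polyC /=; ring.
Qed.

(** * Orthogonality for a Pearson functional *)

Section pearson_functional.
Variables (R : realType) (b : R) (L : {scalar {poly R}}).
Hypothesis pearson : forall p, L ('X * p^`() + ((b + 1)%:P - 'X) * p) = 0.

(** The raising operator has adjoint q |-> x q' - n q, since the Pearson
    identity at L_n q moves the derivative from L_n to q. *)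
Lemma pearson_laguerreS n q :
  L (laguerre b n.+1 * q) = L (laguerre b n * ('X * q^`() - n%:R *: q)).
Proof.
rewrite laguerre_raising -[LHS]addr0 -(pearson (laguerre b n * q)) -linearD.
rewrite derivM.
congr (L _); rewrite -!mul_polyC; ring.
Qed.

(** For m <= n the right-hand side vanishes by induction, the factor m - n
    disposing of the first term when m = n; for m = n + 1 the first term vanishes
    by orthogonality and the second one is a multiple of the norm of L_n. *)
Lemma pearson_laguerre_step m n :
  L (laguerre b n.+1 * laguerre b m) =
    (m%:R - n%:R) * L (laguerre b n * laguerre b m)
    + (m%:R * (m%:R + b)) * L (laguerre b n * laguerre b m.-1).
Proof.
rewrite pearson_laguerreS laguerre_lowering -!linearZ -linearD.
congr (L _); rewrite -!mul_polyC; ring.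
Qed.

Lemma pearson_laguerre_orth n m : (m < n)%N ->
  L (laguerre b n * laguerre b m) = 0.
Proof.
elim: n m => [//|n IH] m; rewrite ltnS leq_eqVlt => /predU1P[->|mn].
  rewrite pearson_laguerre_step subrr mul0r add0r.
  by case: n IH => [|n] IH; rewrite ?mul0r// IH ?mulr0.
have m1n := leq_ltn_trans (leq_pred m) mn.
by rewrite pearson_laguerre_step (IH _ mn) (IH _ m1n) !mulr0 addr0.
Qed.

Lemma pearson_laguerre_norm n :
  L (laguerre b n * laguerre b n) =
  (\prod_(k < n) (k.+1%:R * (k.+1%:R + b))) * L 1.
Proof.
elim: n => [|n IH]; first by rewrite big_ord0 mul1r mulr1.
have orth : L (laguerre b n * laguerre b n.+1) = 0.
  by rewrite mulrC pearson_laguerre_orth.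
rewrite pearson_laguerre_step orth mulr0 add0r IH big_ord_recr /= mulrA.
by rewrite [X in X * _]mulrC.
Qed.
End pearson_functional.

(** * Integration against a density *)

Section density.
Import HBNNSimple.

(** By monotone convergence it suffices to treat simple functions, and by
    linearity indicators, for which the formula is the hypothesis on nu. *)
Lemma ge0_integral_density d (T : measurableType d) (R : realType)
    (mu nu : {measure set T -> \bar R}) (w : T -> R) :
  measurable_fun setT w -> (forall x, 0 <= w x) ->
  (forall A, measurable A -> nu A = (\int[mu]_(x in A) (w x)%:E)%E) ->
  forall f : T -> \bar R, measurable_fun setT f -> (forall x, 0 <= f x)%E ->
  (\int[nu]_x f x = \int[mu]_x (f x * (w x)%:E))%E.
Proof.
move=> mw w0 nuE f mf f0.
have mwE : measurable_fun setT (EFin \o w) by exact/measurable_EFinP.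
pose h := nnsfun_approx measurableT mf.
have hf x : (EFin \o h n) x @[n --> \oo] --> f x.
  exact: (cvg_nnsfun_approx measurableT mf).
have nd_h x : {homo (fun n => h n x) : a b / (a <= b)%N >-> a <= b}.
  by move=> a b ab; exact/lefP/nd_nnsfun_approx.
transitivity (limn (fun n => \int[nu]_x (h n x)%:E)%E).
  under eq_integral => x _ do rewrite -(cvg_lim _ (hf x))//.
  apply: monotone_convergence => //.
  - by move=> n; apply/measurable_EFinP; exact: measurable_funP.
  - by move=> n x _; rewrite lee_fin.
  - by move=> x _ a b ab; rewrite lee_fin nd_h.
transitivity (limn (fun n => \int[mu]_x ((h n x)%:E * (w x)%:E))%E); last first.
  under [RHS]eq_integral => x _.
    rewrite -(cvg_lim _ (cvgeZr _ (hf x)))//; over.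
  apply/esym; apply: monotone_convergence => //.
  - move=> n; apply: emeasurable_funM => //.
    by apply/measurable_EFinP; exact: measurable_funP.
  - by move=> n x _; rewrite mule_ge0// lee_fin.
  - by move=> x _ a b ab; rewrite lee_wpmul2r ?lee_fin ?nd_h.
congr (limn _); apply/funext => n.
have m1 y : measurable_fun setT (fun x => (y * \1_(h n @^-1` [set y]) x)%:E).
  by apply/measurable_EFinP; exact: measurable_funM.
under eq_integral => x _ do rewrite fimfunE -fsumEFin//.
transitivity (\int[mu]_x (\sum_(y \in range (h n))
    (y * \1_(h n @^-1` [set y]) x)%:E * (w x)%:E))%E; last first.
  apply: eq_integral => x _; rewrite -ge0_mule_fsuml => [|y].
    by rewrite fsumEFin// -(fimfunE (h n)).
  exact: nnfun_muleindic_ge0.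
rewrite !ge0_integral_fsum//; last 3 first.
- by move=> y; apply: emeasurable_funM.
- move=> y x _; apply: mule_ge0; first exact: nnfun_muleindic_ge0.
  by rewrite lee_fin.
- by move=> y x _; exact: nnfun_muleindic_ge0.
apply: eq_fsbigr => r _.
under eq_integral do rewrite EFinM.
rewrite integralZl_indic_nnsfun// integral_indic// setIT.
under [RHS]eq_integral do rewrite EFinM -muleA.
(* A negative r is not a value of h n: its level set is empty. *)
have [r0|r0] := ltP r 0.
  have h0 : h n @^-1` [set r] = set0.
    apply/seteqP; split => // x /= hr.
    by have : 0 <= h n x by []; rewrite hr leNgt r0.
  rewrite h0 measure0 mule0 integral0_eq// => x _.
  by rewrite indicE in_set0 mul0e mule0.
rewrite ge0_integralZl//; last 2 first.
- by apply: emeasurable_funM => //; apply/measurable_EFinP.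
- by move=> x _; rewrite mule_ge0// lee_fin.
congr (_ * _)%E; rewrite nuE// integral_mkcond; apply: eq_integral => x _.
by rewrite epatch_indic /= muleC.
Qed.

Lemma integral_density d (T : measurableType d) (R : realType)
    (mu nu : {measure set T -> \bar R}) (w : T -> R) :
  measurable_fun setT w -> (forall x, 0 <= w x) ->
  (forall A, measurable A -> nu A = (\int[mu]_(x in A) (w x)%:E)%E) ->
  forall f : T -> R, measurable_fun setT f ->
  mu.-integrable setT (fun x => (f x * w x)%:E) ->
  nu.-integrable setT (EFin \o f) /\
  (\int[nu]_x (f x)%:E = \int[mu]_x (f x * w x)%:E)%E.
Proof.
move=> mw w0 nuE f mf ifw.
have mfE : measurable_fun setT (EFin \o f) by exact/measurable_EFinP.
split.
  apply/integrableP; split => //.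
  rewrite (ge0_integral_density _ _ _ mu nu w)//; last exact: measurableT_comp.
  move/integrableP : ifw => [_].
  by under eq_integral do rewrite /= normrM (ger0_norm (w0 _)).
rewrite integralE [RHS]integralE; congr (_ - _)%E.
  rewrite (ge0_integral_density _ _ _ mu nu w)//; last exact: measurable_funepos.
  apply: eq_integral => x _.
  by rewrite !funeposE -!EFin_max -EFinM maxr_pMl// mul0r.
rewrite (ge0_integral_density _ _ _ mu nu w)//; last exact: measurable_funeneg.
apply: eq_integral => x _.
by rewrite !funenegE -!EFinN -!EFin_max -EFinM maxr_pMl// mul0r mulNr.
Qed.

End density.

(** * The integrals of the Gamma function *)

Definition gamma_integrand {R : realType} (s x : R) : R := x `^ s * expR (- x).

Section gamma_integrand.
Context {R : realType}.
Implicit Types s x : R.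
Notation mu := (@lebesgue_measure R).
Notation G := (@gamma_integrand R).

Lemma gamma_integrand_ge0 s x : 0 <= G s x.
Proof. by rewrite mulr_ge0 ?powR_ge0 ?expR_ge0. Qed.

Lemma gamma_integrand0 s : 0 < s -> G s 0 = 0.
Proof. by move=> s0; rewrite /gamma_integrand powR0 ?gt_eqF// mul0r. Qed.

Lemma gamma_integrandS s x : 0 < x -> G (s + 1) x = x * G s x.
Proof.
move=> x0; rewrite /gamma_integrand powRD; last by rewrite (gt_eqF x0) implybT.
by rewrite powRr1 ?ltW// -mulrA mulrCA.
Qed.

(** Squeezed by (n+1)!/x for an integer n >= s, because x^(n+1)/(n+1)! <= e^x. *)
Lemma cvg_gamma_integrand_pinfty s : G s x @[x --> +oo] --> (0 : R).
Proof.
have [n sn] : exists n : nat, s <= n%:R.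
  exists (Num.truncn `|s|).+1; apply: le_trans (ler_norm s) _.
  by apply: ltW; rewrite truncnS_gt.
apply: (@squeeze_cvgr _ _ _ _ (cst 0) (fun x => n.+1`!%:R * x^-1)).
- near=> x; rewrite gamma_integrand_ge0/=.
  have x1 : 1 <= x by near: x; apply: nbhs_pinfty_ge; exact: num_real.
  have x0 : 0 < x by exact: lt_le_trans x1.
  have le1 : x `^ s <= x ^+ n by rewrite -powR_mulrn ?(ltW x0)// ler_powR.
  apply: (le_trans (ler_wpM2r (expR_ge0 _) le1)).
  rewrite expRN ler_pdivrMr ?expR_gt0//.
  have -> : x ^+ n = n.+1`!%:R / x * (x ^+ n.+1 / n.+1`!%:R).
    by rewrite exprS; field; rewrite (gt_eqF x0) pnatr_eq0 -lt0n fact_gt0.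
  rewrite ler_wpM2l ?divr_ge0 ?(ltW x0)//.
  by apply: le_trans (expR_ge1Dxn n (ltW x0)); rewrite lerDr.
- exact: cvg_cst.
- rewrite -(mulr0 (n.+1`!%:R : R)); apply: cvgM; first exact: cvg_cst.
  by apply/gtr0_cvgV0 => //; exact: nbhs_pinfty_gt.
Unshelve. all: by end_near. Qed.

Lemma is_derive_gamma_integrand s x : 0 < x ->
  is_derive x 1 (G (s + 1)) ((s + 1) * G s x - G (s + 1) x).
Proof.
move=> x0.
have dN : is_derive x 1 (fun y : R => expR (- y)) (- expR (- x)).
  apply: is_derive_eq. by rewrite mulrN1.
have dP := is_derive1_powR (s + 1) x0.
have dPN := is_deriveM dP dN.
apply: is_derive_eq.
rewrite addrK /gamma_integrand /GRing.scale /=; ring.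
Qed.

Lemma cvg_gamma_integrand_at0 s : 0 < s -> G s x @[x --> 0^'+] --> G s 0.
Proof.
move=> s0; rewrite /gamma_integrand; apply: cvgM.
  by rewrite powR0 ?gt_eqF//; exact: powR_cvg0.
apply: cvg_at_right_filter.
by apply: continuous_comp; [exact: opp_continuous|exact: continuous_expR].
Qed.

Lemma continuous_gamma_integrand s : 0 < s ->
  {within `[0, +oo[, continuous (G s)}.
Proof.
move=> s0; apply: derivable_oy_Rcontinuous_within_itvcy; split.
  move=> x; rewrite in_itv/= andbT => x0.
  by have := is_derive_gamma_integrand (s - 1) x x0; rewrite subrK => -[].
exact: cvg_gamma_integrand_at0.
Qed.

Lemma measurable_gamma_integrand s : measurable_fun setT (G s).
Proof.
apply: measurable_funM; first exact: measurable_powR.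
exact: measurableT_comp (@measurable_expR R) (@oppr_measurable R setT).
Qed.


Lemma within_continuous_dgamma s (D : interval R) : 0 < s ->
  [set` D] `<=` `[0, +oo[ ->
  {within [set` D], continuous (fun x => (s + 1) * G s x - G (s + 1) x)}.
Proof.
move=> s0 D0; apply: continuous_subspaceW D0 _ => x; apply: cvgB.
  by apply: cvgM; [exact: cvg_cst|exact: continuous_gamma_integrand].
by apply: continuous_gamma_integrand; rewrite addr_gt0.
Qed.

(** The derivative of x^(s+1) e^-x has constant sign beyond s + 1, which makes
    the fundamental theorem of calculus available on an unbounded interval
    before any integrability is known. *)
Lemma integral_dgamma_tail s c : 0 < s -> s + 1 <= c ->
  (\int[mu]_(x in `[c, +oo[) (G (s + 1) x - (s + 1) * G s x)%:E =
   (G (s + 1) c)%:E)%E.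
Proof.
move=> s0 sc; have c0 : 0 < c by lra.
have dG x : c < x -> is_derive x 1 (- G (s + 1))
    (G (s + 1) x - (s + 1) * G s x).
  move=> cx; have := is_derive_gamma_integrand s x (lt_trans c0 cx) => h.
  by apply: is_derive_eq; rewrite opprB.
rewrite (@ge0_continuous_FTC2y R _ (- G (s + 1)) c 0).
- by rewrite opprfctE EFinN oppeK add0e.
- move=> x cx; rewrite gamma_integrandS ?(lt_le_trans c0)// -mulrBl.
  by rewrite mulr_ge0 ?gamma_integrand_ge0// subr_ge0 (le_trans sc).
- rewrite (_ : (fun x => _) =
                - (fun x => (s + 1) * G s x - G (s + 1) x)); last first.
    by apply/funext => x; rewrite /= opprfctE opprB.
  move=> x; apply: cvgN; move: x; apply: within_continuous_dgamma => //.
  by apply: subset_itvr; rewrite bnd_simp ltW.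
- rewrite -oppr0; apply: cvgN; exact: cvg_gamma_integrand_pinfty.
- by move=> x /dG[].
- apply: cvgN; apply: cvg_at_right_filter.
  apply: differentiable_continuous; apply/derivable1_diffP.
  by have [] := is_derive_gamma_integrand s c c0.
- by move=> x; rewrite in_itv/= andbT => /dG h; rewrite derive1E derive_val.
Qed.

Lemma itv0y_setU (c : R) : 0 <= c ->
  `[0, +oo[%classic = `[0, c[%classic `|` `[c, +oo[%classic.
Proof. by move=> c0; rewrite -itv_bndbnd_setU// bnd_simp. Qed.

(** Near 0 by continuity; at infinity, x^s e^-x is dominated by
    (x - (s+1)) x^s e^-x, whose integral is known. *)
Lemma integrable_gamma_integrand s : 0 < s ->
  mu.-integrable `[0, +oo[ (EFin \o G s).
Proof.
move=> s0; have mG D : measurable_fun D (EFin \o G s).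
  by apply/measurable_funTS/measurable_EFinP; exact: measurable_gamma_integrand.
apply/integrableP; split; first exact: mG.
under eq_integral do rewrite /= ger0_norm ?gamma_integrand_ge0//.
(* From s + 2 on, the factor x - (s+1) is at least 1. *)
pose c := s + 2; have c0 : 0 <= c by rewrite /c; lra.
rewrite (itv0y_setU c c0) ge0_integral_setU//=; last 3 first.
- exact: mG.
- by move=> x _; rewrite lee_fin gamma_integrand_ge0.
- apply/disj_setPS => x [] /=; rewrite !in_itv/= => /andP[_ xc].
  by rewrite andbT leNgt xc.
rewrite lte_add_pinfty//.
  have : mu.-integrable `[0, c] (EFin \o G s).
    apply: continuous_compact_integrable; first exact: segment_compact.
    apply: continuous_subspaceW (continuous_gamma_integrand s s0).
    exact: subset_itvl.
  move=> iGc; apply: integrable_lty => //; apply: integrableS iGc => //.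
  exact: subset_itv_co_cc.
apply: (@le_lt_trans _ _ (\int[mu]_(x in `[c, +oo[)
    (G (s + 1) x - (s + 1) * G s x)%:E)%E).
  apply: ge0_le_integral => //.
  - by move=> x _; rewrite lee_fin gamma_integrand_ge0.
  - exact: mG.
  - apply/measurable_funTS/measurable_EFinP; apply: measurable_funB.
      exact: measurable_gamma_integrand.
    by apply: measurable_funM => //; exact: measurable_gamma_integrand.
  - move=> x /=; rewrite in_itv/= andbT => cx; rewrite lee_fin.
    rewrite gamma_integrandS; last by move: cx; rewrite /c; lra.
    rewrite -mulrBl ler_peMl ?gamma_integrand_ge0//; move: cx; rewrite /c; lra.
by rewrite integral_dgamma_tail ?ltry// /c; lra.
Qed.

(** The functional equation of the Gamma function: the integral of the
    derivative of x^(s+1) e^-x vanishes, the contributions of the two sides of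
    s + 1 being opposite. *)
Lemma integral_gamma_integrandS s : 0 < s ->
  \int[mu]_(x in `[0, +oo[) G (s + 1) x =
  (s + 1) * \int[mu]_(x in `[0, +oo[) G s x.
Proof.
move=> s0; have s1 : 0 < s + 1 by rewrite addr_gt0.
pose f x := (s + 1) * G s x - G (s + 1) x.
have iG := integrable_gamma_integrand s s0.
have iG1 := integrable_gamma_integrand (s + 1) s1.
have isG : mu.-integrable `[0, +oo[ (EFin \o (fun x => (s + 1) * G s x)).
  exact: (integrableZl _ _ iG).
have if_ : mu.-integrable `[0, +oo[ (EFin \o f) by exact: (integrableB _ isG iG1).
apply/esym/eqP; rewrite -subr_eq0 -RintegralZl// -RintegralB//.
rewrite (itv0y_setU (s + 1) (ltW s1)) Rintegral_setU//; last 2 first.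
- by rewrite -itv0y_setU// ltW.
- apply/disj_setPS => x [] /=; rewrite !in_itv/= => /andP[_ xc].
  by rewrite andbT leNgt xc.
rewrite Rintegral_itv_bndo_bndc; last first.
  by apply: integrableS if_ => //; exact: subset_itvl.
rewrite {1}/Rintegral (@continuous_FTC2 R f (G (s + 1))) //; last 3 first.
- by apply: within_continuous_dgamma => //; exact: subset_itvl.
- split.
  + move=> x; rewrite in_itv/= => /andP[x0 _].
    by have [] := is_derive_gamma_integrand s x x0.
  + exact: cvg_gamma_integrand_at0.
  + apply: cvg_at_left_filter.
    apply: differentiable_continuous; apply/derivable1_diffP.
    by have [] := is_derive_gamma_integrand s (s + 1) s1.
- move=> x; rewrite in_itv/= => /andP[x0 _]; rewrite derive1E.
  by have := is_derive_gamma_integrand s x x0 => h; rewrite derive_val.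
rewrite -EFinB gamma_integrand0// subr0 /=.
have iD : mu.-integrable `[0, +oo[
    (EFin \o (fun x => G (s + 1) x - (s + 1) * G s x)).
  exact: (integrableB _ iG1 isG).
have sub : `[s + 1, +oo[ `<=` (`[0, +oo[ : set R).
  by apply: subset_itvr; rewrite bnd_simp ltW.
have tail : \int[mu]_(x in `[s + 1, +oo[) (G (s + 1) x - (s + 1) * G s x) =
    G (s + 1) (s + 1) by rewrite /Rintegral integral_dgamma_tail.
rewrite -tail -RintegralD//; last 2 first.
- by apply: integrableS iD.
- by apply: integrableS if_.
rewrite (@eq_Rintegral _ _ _ _ _ (cst 0)) ?Rintegral_cst ?mul0r// => x _.
by rewrite /f addrC subrKA subrr.
Qed.

(** The integral of x^(s+1) e^-x, which is a positive multiple of this one,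
    exceeds the tail integral computed in [integral_dgamma_tail]. *)
Lemma integral_gamma_integrand_gt0 s : 0 < s ->
  0 < \int[mu]_(x in `[0, +oo[) G s x.
Proof.
move=> s0; have s1 : 0 < s + 1 by rewrite addr_gt0.
have iG1 := integrable_gamma_integrand (s + 1) s1.
have iG := integrable_gamma_integrand s s0.
have iD : mu.-integrable `[0, +oo[
    (EFin \o (fun x => G (s + 1) x - (s + 1) * G s x)).
  exact: (integrableB _ iG1 (integrableZl _ _ iG)).
have sub : `[s + 1, +oo[ `<=` (`[0, +oo[ : set R).
  by apply: subset_itvr; rewrite bnd_simp ltW.
rewrite -(pmulr_rgt0 _ s1) -integral_gamma_integrandS//.
rewrite (itv0y_setU (s + 1) (ltW s1)) Rintegral_setU//; last 2 first.
- by rewrite -itv0y_setU// ltW.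
- apply/disj_setPS => x [] /=; rewrite !in_itv/= => /andP[_ xc].
  by rewrite andbT leNgt xc.
apply: ltr_wpDl; first by apply: Rintegral_ge0 => x _; exact: gamma_integrand_ge0.
have tail : \int[mu]_(x in `[s + 1, +oo[) (G (s + 1) x - (s + 1) * G s x) =
    G (s + 1) (s + 1) by rewrite /Rintegral integral_dgamma_tail.
have G0 : 0 < G (s + 1) (s + 1) by rewrite mulr_gt0 ?powR_gt0 ?expR_gt0.
apply: (lt_le_trans G0); rewrite -tail.
apply: le_Rintegral => //.
- by apply: integrableS iD.
- by apply: integrableS iG1.
- by move=> x _; rewrite gerBl mulr_ge0 ?gamma_integrand_ge0// ltW.
Qed.
End gamma_integrand.

(** * The Laguerre functional *)

Section laguerre_functional.
Context {R : realType}.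
Notation mu := (@lebesgue_measure R).
Notation G := (@gamma_integrand R).

(** Multiplying a polynomial by x amounts to raising the exponent b by 1; this
    lets the next proofs go by induction on the polynomial for all b at once. *)
Lemma horner_gamma_mulX (b x : R) (p : {poly R}) : 0 < b ->
  `[0, +oo[%classic x ->
  ('X * p).[x] * G b x = p.[x] * G (b + 1) x.
Proof.
move=> b0 /=; rewrite in_itv/= andbT le_eqVlt => /predU1P[<-|x0].
  by rewrite !gamma_integrand0 ?mulr0// addr_gt0.
by rewrite gamma_integrandS// hornerM hornerX; ring.
Qed.

Lemma integrable_horner_gamma (b : R) (p : {poly R}) : 0 < b ->
  mu.-integrable `[0, +oo[ (EFin \o (fun x => p.[x] * G b x)).
Proof.
elim/poly_ind: p b => [|p c IH] b b0.
  apply: (eq_integrable _ (cst 0%E)) => //; last exact: integrable0.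
  by move=> x _; rewrite /= horner0 mul0r.
have b1 : 0 < b + 1 by rewrite addr_gt0.
have ip := IH _ b1.
have ic : mu.-integrable `[0, +oo[ (EFin \o (fun x => c * G b x)).
  exact: (integrableZl _ _ (integrable_gamma_integrand b b0)).
apply: eq_integrable (integrableD _ ip ic) => //.
move=> x; rewrite inE => x0 /=.
by rewrite hornerD hornerC mulrDl [p * _]mulrC horner_gamma_mulX// EFinD EFinM.
Qed.

(** The positivity of b is an argument because linearity rests on the
    convergence of the integrals. *)
Definition laguerre_functional (b : R) (b0 : 0 < b) (p : {poly R}) : R :=
  \int[mu]_(x in `[0, +oo[) (p.[x] * G b x).

Section linear.
Variables (b : R) (b0 : 0 < b).

Lemma laguerre_functional_is_scalar : scalar (laguerre_functional b b0).
Proof.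
move=> k p q; rewrite /laguerre_functional.
have ip := integrable_horner_gamma b p b0.
have iq := integrable_horner_gamma b q b0.
have ikp : mu.-integrable `[0, +oo[ (EFin \o (fun x => k * (p.[x] * G b x))).
  exact: (integrableZl _ _ ip).
rewrite -RintegralZl// -RintegralD//.
by apply: eq_Rintegral => x _; rewrite hornerD hornerZ mulrDl -mulrA.
Qed.

HB.instance Definition _ := GRing.isLinear.Build R {poly R} R *%R
  (laguerre_functional b b0) laguerre_functional_is_scalar.
End linear.

Lemma laguerre_functional_mulX b (b0 : 0 < b) (b1 : 0 < b + 1) p :
  laguerre_functional b b0 ('X * p) = laguerre_functional (b + 1) b1 p.
Proof.
by apply: eq_Rintegral => x; rewrite inE => x0; rewrite horner_gamma_mulX.
Qed.

Lemma laguerre_functional1 b (b0 : 0 < b) :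
  laguerre_functional b b0 1 = \int[mu]_(x in `[0, +oo[) G b x.
Proof. by apply: eq_Rintegral => x _; rewrite hornerC mul1r. Qed.

(** For p = x q + c, the Pearson operator with parameter b produces x times the
    operator with parameter b + 1 applied to q, plus c (b + 1 - x), whose
    integral vanishes by [integral_gamma_integrandS]. *)
Lemma laguerre_functional_pearson b (b0 : 0 < b) p :
  laguerre_functional b b0 ('X * p^`() + ((b + 1)%:P - 'X) * p) = 0.
Proof.
elim/poly_ind: p b b0 => [|p c IH] b b0.
  by rewrite deriv0 !mulr0 addr0 linear0.
have b1 : 0 < b + 1 by rewrite addr_gt0.
have -> : 'X * (p * 'X + c%:P)^`() + ((b + 1)%:P - 'X) * (p * 'X + c%:P) =
    'X * ('X * p^`() + ((b + 1 + 1)%:P - 'X) * p)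
    + c *: ((b + 1) *: 1 - 'X * 1) :> {poly R}.
  rewrite derivD derivM derivX derivC -!mul_polyC; ring.
rewrite linearD linearZ linearB linearZ /= !laguerre_functional_mulX IH add0r.
by rewrite !laguerre_functional1 integral_gamma_integrandS// subrr mulr0.
Qed.
End laguerre_functional.

(** The factor x^2 raises the exponent of the weight from alpha to alpha + 2. At
    x = 0, where the weight is cut off, x^(alpha+2) vanishes as well, so the
    interval may be closed. *)
Lemma laguerre_measure_poly {R : realType} (alpha : R) (halpha : -1 < alpha)
    (b0 : 0 < alpha + 2) (p q : {poly R}) :
  p = 'X * ('X * q) ->
  (laguerre_measure alpha).-integrable setT (EFin \o horner p) /\
  (\int[laguerre_measure alpha]_x (p.[x])%:E =
     (laguerre_functional (alpha + 2) b0 q)%:E)%E.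
Proof.
move=> pE.
have wE : (fun x : R => (p.[x] * laguerre_weight alpha x)%:E) =
    (EFin \o (fun x => q.[x] * gamma_integrand (alpha + 2) x)) \_ `[0, +oo[.
  apply/funext => x; rewrite /laguerre_weight !patchE !mem_setE !in_itv/= !andbT.
  have [x0|x0|<-] := ltgtP 0 x; last 2 first.
  - by rewrite mulr0.
  - by rewrite /= gamma_integrand0// !mulr0.
  rewrite /= pE !hornerM hornerX (_ : alpha + 2 = alpha + 1 + 1); last by ring.
  by rewrite !gamma_integrandS//; congr EFin; rewrite /gamma_integrand; ring.
have ipw : lebesgue_measure.-integrable setT
    (fun x : R => (p.[x] * laguerre_weight alpha x)%:E).
  rewrite wE -integrable_mkcond//; exact: integrable_horner_gamma.
have mp : measurable_fun setT (horner p).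
  by apply: continuous_measurable_fun; exact: continuous_horner.
have [ip ->] := integral_density _ _ _ lebesgue_measure (laguerre_measure alpha)
  _ (measurable_laguerre_weight alpha) (laguerre_weight_ge0 alpha)
  (fun _ _ => erefl) _ mp ipw.
split=> //; rewrite wE -integral_mkcond /laguerre_functional /Rintegral fineK//.
by apply: integrable_fin_num => //; exact: integrable_horner_gamma.
Qed.

(** * Quasi-Christoffel Laguerre polynomials *)

Theorem mainTheorem4 (R : realType) (alpha : R) (halpha : -1 < alpha) :
  (forall gamma : nat -> R,
     [/\ solves_gamma_eq alpha gamma,
         gamma 1%N = alpha + 2 & gamma 2%N = alpha + 3]
     <-> (forall n : nat, (1 <= n)%N -> gamma n = n%:R + alpha + 1)) /\
  let LQC := laguerreQC alpha (fun n : nat => n%:R + alpha + 1) in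
  [/\ (forall n : nat, (1 <= n)%N ->
         LQC n = 'X * laguerre (alpha + 2) n.-1),
      (forall n : nat, (2 <= n)%N ->
         LQC n.+1 = ('X - (2 * n%:R + alpha + 1)%:P) * LQC n
                    - ((n%:R - 1) * (n%:R + alpha + 1)) *: LQC n.-1)
    & orthogonal_polys (laguerre_measure alpha) 1 LQC].
Proof.
split; first exact: gamma_solution_unique.
move=> LQC.
have LQCE n : LQC n.+1 = 'X * laguerre (alpha + 2) n.
  rewrite /LQC /laguerreQC (_ : alpha + 2 = alpha + 1 + 1); last by ring.
  by rewrite -laguerre_connection; congr (_ + _ *: _); ring.
split.
- by case.
- case=> [|[|n]]// _; rewrite !LQCE laguerreSS -!mul_polyC; ring.
- case=> [|n] [|m]// _ _.
  have b0 : 0 < alpha + 2 by lra.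
  have E : LQC n.+1 * LQC m.+1 =
      'X * ('X * (laguerre (alpha + 2) n * laguerre (alpha + 2) m)).
    by rewrite !LQCE; ring.
  have [i ->] : (laguerre_measure alpha).-integrable setT
        (fun x : R => ((LQC n.+1).[x] * (LQC m.+1).[x])%:E) /\
      (\int[laguerre_measure alpha]_x ((LQC n.+1).[x] * (LQC m.+1).[x])%:E =
       (laguerre_functional (alpha + 2) b0
          (laguerre (alpha + 2) n * laguerre (alpha + 2) m))%:E)%E.
    have -> : (fun x : R => ((LQC n.+1).[x] * (LQC m.+1).[x])%:E) =
        EFin \o horner (LQC n.+1 * LQC m.+1).
      by apply/funext => x; rewrite /= hornerM.
    exact: laguerre_measure_poly.
  have pearson := laguerre_functional_pearson (alpha + 2) b0.
  split=> //.
  + rewrite eqSS neq_ltn => /orP[nm|mn]; last by rewrite pearson_laguerre_orth.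
    by rewrite mulrC pearson_laguerre_orth.
  + move=> [<-]; rewrite pearson_laguerre_norm// => -[] /eqP.
    apply/negP; rewrite mulf_neq0//.
      apply/prodf_neq0 => k _; rewrite mulf_neq0 ?pnatr_eq0//.
      by rewrite gt_eqF// addr_gt0// ltr0n.
    by rewrite laguerre_functional1 gt_eqF// integral_gamma_integrand_gt0.
Qed.
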